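(* Let $n \ge 2$ be an integer such that $\{\log_2(3n)\} < 1 - \{\log_2 3\}$ or $\{\log_2(3n)\} \ge \{\log_2 3\}$. Then $\mathsf{D}_{\pm}(C_3 \oplus C_{3n}) = \lfloor \log_2(9n) \rfloor + 1$.
   Context: $C_m$ denotes a cyclic group of order $m$; $\{x\} = x - \lfloor x\rfloor$ is the fractional part. For a finite abelian group $G$ (written additively), $\mathsf{D}_{\pm}(G)$ is the smallest positive integer $\ell$ such that for every sequence $g_1,\dots,g_k$ of elements of $G$ (repetitions allowed) with $k \ge \ell$ there exist a non-empty subset $I \subset \{1,\dots,k\}$ and $a_i \in \{+1,-1\}$ ($i\in I$) with $\sum_{i \in I} a_i g_i = 0$. *)

(* Defs.v *)
From HB Require Import structures.
From mathcomp Require Import all_boot all_order all_algebra.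
From mathcomp Require Import boolp reals sequences exp.
Set Implicit Arguments.
Unset Strict Implicit.
Unset Printing Implicit Defensive.
Import Order.TTheory GRing.Theory Num.Theory.
Local Open Scope ring_scope.

(* finalg provides no finZmodType instance on products. *)
HB.instance Definition _ (A B : finZmodType) := GRing.Zmodule.on (A * B)%type.

Definition log2 (R : realType) (x : R) : R := ln x / ln 2.

Definition fracpart (R : realType) (x : R) : R := x - (Num.floor x)%:~R.

Definition has_pm_zero_subsum (G : zmodType) (k : nat) (g : 'I_k -> G) : Prop :=
  exists (I : {set 'I_k}) (a : 'I_k -> int),
    [/\ I != set0,
        forall i, i \in I -> a i = 1 \/ a i = -1
      & \sum_(i in I) g i *~ a i = 0].

Definition pm_zero_subsum_from (G : zmodType) (l : nat) : Prop :=
  forall (k : nat) (g : 'I_k -> G), (l <= k)%N -> has_pm_zero_subsum g.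

(* Pigeonhole on the #|G| + 1 first partial sums: l = #|G| always works. *)
Lemma pm_davenport_exists (G : finZmodType) :
  exists l : nat, (0 < l)%N && `[< pm_zero_subsum_from G l >].
Proof.
exists #|G|; apply/andP; split; first by apply/card_gt0P; exists 0.
apply/asboolP => k g le_Gk.
pose S (j : 'I_k.+1) : G := \sum_(x < k | (x < j)%N) g x.
have /injectivePn [i [j neq_ij eqS]] : ~~ injectiveb S.
  apply/negP => /injectiveP /leq_card; rewrite card_ord => lt_kG.
  by have := leq_trans lt_kG le_Gk; rewrite ltnn.
wlog lt_ij : i j neq_ij eqS / (i < j)%N.
  move=> H; case: (ltngtP i j) => [lt_ij|lt_ji|/val_inj eq_ij].
  - exact: (H i j).
  - by apply: (H j i) => //; rewrite eq_sym.
  - by rewrite eq_ij eqxx in neq_ij.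
have lt_ik : (i < k)%N by apply: leq_trans lt_ij _; rewrite -ltnS.
exists [set x : 'I_k | (i <= x < j)%N], (fun=> 1); split.
- by apply/set0Pn; exists (Ordinal lt_ik); rewrite inE /= leqnn lt_ij.
- by move=> x _; left.
have -> : \sum_(x in [set x : 'I_k | (i <= x < j)%N]) g x *~ 1 = S j - S i.
  apply/eqP; rewrite eq_sym subr_eq /S (bigID (fun x : 'I_k => (x < i)%N)) /=.
  rewrite addrC; apply/eqP; congr (_ + _); apply: eq_big => x //.
  - by rewrite inE -leqNgt andbC.
  - case: (ltnP x i) => [lt_xi|_]; last by rewrite andbF.
    by rewrite (ltn_trans lt_xi lt_ij).
by rewrite eqS subrr.
Qed.

Definition pm_davenport (G : finZmodType) : nat := ex_minn (pm_davenport_exists G).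

(* Main.v *)
(* Upper bound: if [2 ^ l > #|G|], two distinct subsets of the sequence have the
   same sum, and their difference is a signed zero subsum.
   Lower bound: let [2 ^ k <= 3 n < 2 ^ (k + 1)]. The elements
   [(1, 0), (0, 1), (0, 2), ..., (0, 2 ^ (k - 1))] have no signed zero subsum,
   which suffices unless [9 n >= 2 ^ (k + 2)]. In that case the hypothesis on
   the fractional parts forces [n >= 2 ^ (k - 1)], and with [h = 2 ^ (k - 2)]
   the [k + 2] elements [(0, 1), (0, 2), ..., (0, h), (1, - h), (1, h), (1, 3 h)]
   have none either: the signed sums of the powers of two lie strictly between
   [- 2 h] and [2 h], whereas a nontrivial signed sum of the last three
   elements with first coordinate [0] has second coordinate [2 h], [3 h] or
   [4 h] up to sign, at distance at least [2 h] from every multiple of [3 n]. *)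
Require Import Defs.
From mathcomp Require Import all_boot all_order all_algebra.
From mathcomp Require Import boolp reals exp zify lra.
Import Order.TTheory GRing.Theory Num.Theory.
Local Open Scope ring_scope.

Lemma pm_zero_subsum_from_card (G : finZmodType) (l : nat) :
  (#|G| < 2 ^ l)%N -> pm_zero_subsum_from G l.
Proof.
move=> lt_G k g le_lk.
pose S (A : {set 'I_k}) : G := \sum_(i in A) g i.
have /injectivePn [A [B neq_AB eqS]] : ~~ injectiveb S.
  apply/negP => /injectiveP /leq_card.
  rewrite -cardsT -powersetT card_powerset cardsT card_ord => le_kG.
  have := leq_ltn_trans le_kG lt_G.
  by rewrite ltnNge leq_exp2l ?le_lk.
(* Terms common to [A] and [B] cancel in the difference of the two sums, and what remains is
   nonempty because [A] and [B] differ. *)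
exists ((A :\: B) :|: (B :\: A)), (fun i => if i \in A then 1 else -1); split.
- apply: contra neq_AB => /eqP.
  by move/eqP; rewrite setU_eq0 !setD_eq0 -eqEsubset.
- by move=> i _; case: ifP; [left | right].
have sumD (C D : {set 'I_k}) :
    \sum_(i in C :\: D) g i = S C - \sum_(i in C :&: D) g i.
  by rewrite /S [X in X - _](big_setID D) /= [X in X - _]addrC addrK.
rewrite (eq_bigl _ _ (fun i => in_setU i _ _)) bigU /=; last first.
  by rewrite -setI_eq0; apply/eqP/setP => i; rewrite !inE; case: (i \in A); rewrite ?andbF.
rewrite (eq_bigr g) => [|i]; last by rewrite !inE => /andP [_ ->].
rewrite [X in _ + X](eq_bigr (fun i => - g i)) => [|i]; last first.
  by rewrite !inE => /andP [/negPf -> _]; rewrite mulrN1z.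
by rewrite sumrN !sumD [B :&: A]setIC eqS subrr.
Qed.

Lemma pm_davenport_le (G : finZmodType) (l : nat) :
  (0 < l)%N -> pm_zero_subsum_from G l -> (pm_davenport G <= l)%N.
Proof.
move=> l_gt0 Hl; rewrite /pm_davenport; case: ex_minnP => d _; apply.
by rewrite l_gt0; apply/asboolP.
Qed.

Lemma pm_davenport_gt (G : finZmodType) (k : nat) (g : 'I_k -> G) :
  ~ has_pm_zero_subsum g -> (k < pm_davenport G)%N.
Proof.
move=> Hg; rewrite /pm_davenport; case: ex_minnP => d /andP [_ /asboolP Hd] _.
by rewrite ltnNge; apply/negP => /(Hd _ g).
Qed.

Lemma Zp_intr_eq0 (m : nat) (x : int) :
  (1 < m)%N -> x%:~R = 0 :> 'Z_m -> (m %| x)%Z.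
Proof.
move=> m_gt1.
have natP (p : nat) : p%:R = 0 :> 'Z_m -> (m %| p)%N.
  by move/(congr1 val); rewrite /= val_Zp_nat // => /eqP.
case: x => p; first by move=> /natP; rewrite dvdzE.
by rewrite NegzE mulrNz => /eqP; rewrite oppr_eq0 => /eqP /natP; rewrite dvdzE.
Qed.

Lemma dvdz_small (m : nat) (x : int) : (m %| x)%Z -> - m%:Z < x < m%:Z -> x = 0.
Proof.
rewrite -ltr_norml => /dvdzP [q ->]; rewrite normrM.
case: (eqVneq q 0) => [-> | q0]; first by rewrite mul0r.
by rewrite ltNge ler_peMl // -gtz0_ge1 normr_gt0.
Qed.

(** Bridge to integer arithmetic: a subset with signs becomes one family of coefficients -1, 0, 1,
    and vanishing in a cyclic factor becomes divisibility. Indexing by [nat] lets the last terms be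
    peeled off a sum. *)
Lemma no_pm_zero_subsum (m p k : nat) (a b : nat -> int) :
  (1 < m)%N -> (1 < p)%N ->
  (forall c : nat -> int, (forall i, -1 <= c i <= 1) ->
    (m %| (\sum_(i < k) a i * c i))%Z -> (p %| (\sum_(i < k) b i * c i))%Z ->
    forall i, (i < k)%N -> c i = 0) ->
  ~ has_pm_zero_subsum (fun i : 'I_k => ((a i)%:~R, (b i)%:~R) : 'Z_m * 'Z_p).
Proof.
move=> m_gt1 p_gt1 Hab [I [s [/set0Pn [i0 i0I] sP]]].
(* The value 0 off [I] and beyond [k] keeps the bound on [c] valid at every index. *)
pose c j := if insub j is Some i then (if i \in I then s i else 0) else 0.
have cE (i : 'I_k) : c i = if i \in I then s i else 0.
  by rewrite /c valK.
have coord (q : nat) (u : nat -> int) :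
    \sum_(i in I) ((u i)%:~R : 'Z_q) *~ s i = (\sum_(i < k) u i * c i)%:~R.
  rewrite big_mkcond /= rmorph_sum /=; apply: eq_bigr => i _.
  by rewrite cE; case: ifP; rewrite ?mulr0 // intrM mulrzr.
move=> sum0.
have /(Hab c) : forall i, -1 <= c i <= 1.
  by move=> i; rewrite /c; case: insubP => // j _ _; case: ifP => // /sP [] ->.
have := congr1 fst sum0; rewrite (raddf_sum fst) /=.
rewrite (eq_bigr (fun i : 'I_k => ((a i)%:~R : 'Z_m) *~ s i)); last first.
  by move=> i _; rewrite (raddfMz fst).
have := congr1 snd sum0; rewrite (raddf_sum snd) /=.
rewrite (eq_bigr (fun i : 'I_k => ((b i)%:~R : 'Z_p) *~ s i)); last first.
  by move=> i _; rewrite (raddfMz snd).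
rewrite !coord => /(Zp_intr_eq0 _ _ p_gt1) Hp /(Zp_intr_eq0 _ _ m_gt1) Hm.
move=> /(_ Hm Hp _ (ltn_ord i0)); rewrite cE i0I.
by case: (sP _ i0I) => ->.
Qed.

Lemma sign_cases (x : int) : -1 <= x <= 1 -> [\/ x = -1, x = 0 | x = 1].
Proof.
move=> Hx; have [|[]] : x = -1 \/ x = 0 \/ x = 1 by lia.
- exact: Or31.
- exact: Or32.
- exact: Or33.
Qed.

Lemma signed_binary_bound (k : nat) (c : nat -> int) :
  (forall i, -1 <= c i <= 1) ->
  - (2 ^ k)%N%:Z < \sum_(i < k) (2 ^ i)%N%:Z * c i < (2 ^ k)%N%:Z.
Proof.
move=> Hc; elim: k => [|k IH]; first by rewrite big_ord0.
rewrite big_ord_recr /= expnS PoszM; move: IH.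
move: (\sum_(i < k) _) (Posz (2 ^ k)) => T P.
by case: (sign_cases _ (Hc k)) => ->; lia.
Qed.

(** The lower terms cannot cancel a full [2 ^ k], so the top coefficient vanishes; then descend. *)
Lemma signed_binary_eq0 (k : nat) (c : nat -> int) :
  (forall i, -1 <= c i <= 1) -> \sum_(i < k) (2 ^ i)%N%:Z * c i = 0 ->
  forall i, (i < k)%N -> c i = 0.
Proof.
move=> Hc; elim: k => // k IH; rewrite big_ord_recr /= => sum0.
have ck0 : c k = 0.
  have := signed_binary_bound k c Hc; move: sum0.
  move: (\sum_(i < k) _) (Posz (2 ^ k)) => T P.
  by case: (sign_cases _ (Hc k)) => ->; lia.
move=> i; rewrite ltnS leq_eqVlt => /orP [/eqP -> // | lt_ik].
by apply: IH lt_ik; rewrite ck0 mulr0 addr0 in sum0.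
Qed.

Lemma pm_davenport_gt_binary (n k : nat) :
  (2 <= n)%N -> (2 ^ k <= 3 * n)%N ->
  (k.+1 < pm_davenport ('Z_3 * 'Z_(3 * n))%type)%N.
Proof.
move=> n_ge2 le_k.
pose a i : int := if (i < k)%N then 0 else 1.
pose b i : int := if (i < k)%N then (2 ^ i)%N%:Z else 0.
apply: (@pm_davenport_gt _ _
  (fun i : 'I_k.+1 => ((a i)%:~R, (b i)%:~R) : 'Z_3 * 'Z_(3 * n))).
apply: no_pm_zero_subsum => [||c Hc]; [by [] | lia |].
rewrite !big_ord_recr /= /a /b ltnn mul0r mul1r addr0.
rewrite big1 => [|i _]; last by rewrite ltn_ord mul0r.
(* Only [c k] is left in the first coordinate, and 3 divides it. *)
rewrite add0r => /dvdz_small ck0.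
have {}ck0 : c k = 0 by apply: ck0; have := Hc k; lia.
rewrite (eq_bigr (fun i : 'I_k => (2 ^ i)%N%:Z * c i)); last first.
  by move=> i _; rewrite ltn_ord.
(* As [2 ^ k <= 3 * n], the only multiple of [3 * n] within reach is 0. *)
move=> /dvdz_small sum0.
have {}sum0 : \sum_(i < k) (2 ^ i)%N%:Z * c i = 0.
  apply: sum0; have := signed_binary_bound k c Hc.
  by move: (\sum_(i < k) _) => T; move: le_k; rewrite -lez_nat; lia.
move=> i; rewrite ltnS leq_eqVlt => /orP [/eqP -> // | lt_ik].
exact: (signed_binary_eq0 k c Hc sum0).
Qed.

(** Applied with [m = k - 1]: compared with the previous sequence, one power of two is traded for
    two more elements with first coordinate 1. *)
Lemma pm_davenport_gt_binary3 (n m : nat) :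
  (0 < m)%N -> (2 ^ m <= n)%N -> (m.+3 < pm_davenport ('Z_3 * 'Z_(3 * n))%type)%N.
Proof.
move=> m_gt0 le_n; pose h : int := (2 ^ m.-1)%N%:Z.
have h_gt0 : 0 < h by rewrite /h ltz_nat expn_gt0.
have mE : (2 ^ m)%N%:Z = 2 * h by rewrite -{1}(prednK m_gt0) expnS.
have le_hn : 2 * h <= n%:Z by rewrite -mE lez_nat.
pose a i : int := if (i < m)%N then 0 else 1.
pose b i : int := if (i < m)%N then (2 ^ i)%N%:Z
  else if i == m then - h else if i == m.+1 then h else 3 * h.
apply: (@pm_davenport_gt _ _
  (fun i : 'I_m.+3 => ((a i)%:~R, (b i)%:~R) : 'Z_3 * 'Z_(3 * n))).
apply: no_pm_zero_subsum => [||c Hc]; [by [] | lia |].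
have -> : \sum_(i < m.+3) a i * c i = c m + c m.+1 + c m.+2.
  rewrite !big_ord_recr /= big1 => [|i _]; last by rewrite /a ltn_ord mul0r.
  have aE i : (m <= i)%N -> a i = 1 by rewrite /a ltnNge => ->.
  by rewrite !aE ?mul1r ?add0r //; lia.
have -> : \sum_(i < m.+3) b i * c i = \sum_(i < m) (2 ^ i)%N%:Z * c i
            + (- h * c m + h * c m.+1 + 3 * h * c m.+2).
  rewrite !big_ord_recr /= (eq_bigr (fun i : 'I_m => (2 ^ i)%N%:Z * c i)).
    have -> : b m = - h by rewrite /b ltnn eqxx.
    have -> : b m.+1 = h by rewrite /b ltnNge leqnSn eqxx (gtn_eqF (ltnSn m)).
    have -> : b m.+2 = 3 * h by rewrite /b !ifF //; lia.
    by rewrite !addrA.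
  by move=> i _; rewrite /b ltn_ord.
have := signed_binary_bound m c Hc; rewrite mE.
have := signed_binary_eq0 m c Hc.
move: (\sum_(i < m) _) => T T0 ltT /dvdzP [q Eq] dvdT.
(* Of the 27 sign patterns, those with coefficient sum divisible by 3 and not all zero shift [T] by
   2, 3 or 4 times [h] up to sign. Since [T] is strictly below [2 * h] in absolute value, the total
   is nonzero and strictly below [6 * h <= 3 * n], which contradicts divisibility. *)
have [x0 [x1 [x2 TE]]] : c m = 0 /\ c m.+1 = 0 /\ c m.+2 = 0 /\ T = 0.
  have Hsmall := dvdz_small _ _ dvdT; move: Hsmall Eq {dvdT T0}.
  case: (sign_cases _ (Hc m)) => ->; case: (sign_cases _ (Hc m.+1)) => ->;
    case: (sign_cases _ (Hc m.+2)) => -> Hsmall Eq; lia.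
move=> i; have [lt_im _|] := ltnP i m; first exact: T0.
move=> le_mi lt_i.
have [->|[->|->]] // : i = m \/ i = m.+1 \/ i = m.+2 by lia.
Qed.

Lemma floor_log2_nat (R : realType) (N k : nat) :
  (2 ^ k <= N < 2 ^ k.+1)%N -> Num.floor (log2 (N%:R : R)) = k%:Z.
Proof.
move=> /andP [le_N lt_N]; apply: floor_def.
have ln2_gt0 : 0 < ln (2 : R) by apply: ln_gt0; rewrite ltr1n.
have N_gt0 : (0 < N)%N by apply: leq_trans le_N; rewrite expn_gt0.
have lnX p : ln ((2 ^ p)%N%:R : R) = ln 2 * p%:R by rewrite natrX lnXn // mulr_natr.
have X_gt0 p : ((2 ^ p)%N%:R : R) \is Num.pos by rewrite posrE ltr0n expn_gt0.
have Npos : (N%:R : R) \is Num.pos by rewrite posrE ltr0n.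
have -> : k%:Z + 1 = k.+1%:Z by lia.
rewrite /log2 ler_pdivlMr // ltr_pdivrMr // !(mulrC _ (ln 2)) -!lnX.
by rewrite ler_ln // ltr_ln // ler_nat ltr_nat le_N lt_N.
Qed.

Theorem theorem4p4 (R : realType) (n : nat) (hn : (2 <= n)%N)
  (hfrac : fracpart (log2 (3 * n%:R : R)) < 1 - fracpart (log2 (3 : R)) \/
           fracpart (log2 (3 * n%:R : R)) >= fracpart (log2 (3 : R))) :
  (pm_davenport ('Z_3 * 'Z_(3 * n))%type)%:Z
    = Num.floor (log2 (9 * n%:R : R)) + 1.
Proof.
have /andP [le_k lt_k] := @trunc_log_bounds 2 (3 * n) isT ltac:(lia).
have /andP [le_K lt_K] := @trunc_log_bounds 2 (9 * n) isT ltac:(lia).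
set k := trunc_log 2 (3 * n) in le_k lt_k.
set K := trunc_log 2 (9 * n) in le_K lt_K.
rewrite -[9 * n%:R]natrM (@floor_log2_nat _ _ K) ?le_K //.
have upper : (pm_davenport ('Z_3 * 'Z_(3 * n))%type <= K.+1)%N.
  apply: pm_davenport_le => //; apply: pm_zero_subsum_from_card.
  rewrite card_prod !card_ord (@Zp_cast (3 * n)); last lia.
  by apply: leq_trans lt_K; rewrite Zp_cast //; lia.
suff lower : (K < pm_davenport ('Z_3 * 'Z_(3 * n))%type)%N.
  by move: upper lower; lia.
have k_gt1 : (1 < k)%N.
  rewrite ltnNge; apply/negP => k_le1.
  have := leq_trans lt_k (leq_pexp2l (isT : 0 < 2)%N (k_le1 : k.+1 <= 2)%N).
  by lia.
(* Since [log2 3] has floor 1 and [log2 (3 * n)] has floor [k], the two fractional-part conditions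
   read [log2 (9 * n) < k + 2] and [log2 n >= k - 1]. *)
have [lt_9n | le_n] : (9 * n < 2 ^ k.+2)%N \/ (2 ^ k.-1 <= n)%N.
  have ln2_gt0 : 0 < ln (2 : R) by apply: ln_gt0; rewrite ltr1n.
  have n_gt0 : 0 < n%:R :> R by rewrite ltr0n; lia.
  have lnX p : ln ((2 ^ p)%N%:R : R) = p%:R * ln 2.
    by rewrite natrX lnXn // mulr_natl.
  have X_gt0 p : ((2 ^ p)%N%:R : R) \is Num.pos by rewrite posrE ltr0n expn_gt0.
  move: hfrac; rewrite /fracpart (@floor_log2_nat _ 3 1) // -natrM.
  rewrite (@floor_log2_nat _ _ k) ?le_k // /log2 natrM lnM ?posrE // => hfrac.
  set L := ln 2 in hfrac ln2_gt0 lnX.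
  have div3 : ln 3 / L * L = ln 3 by rewrite divfK ?lt0r_neq0.
  have divn : ln n%:R / L * L = ln n%:R by rewrite divfK ?lt0r_neq0.
  have k_pred : k.-1%:R = k%:R - 1 :> R by rewrite -subn1 natrB //; lia.
  case: hfrac => H; [left | right].
  - rewrite -(ltr_nat R) -ltr_ln ?X_gt0 ?posrE ?ltr0n //; try lia.
    have -> : ln ((9 * n)%N%:R : R) = ln 3 + (ln 3 + ln n%:R).
      by rewrite -!lnM ?posrE ?mulr_gt0 // -!natrM mulnA.
    rewrite lnX -addn2 natrD -div3 -divn.
    by rewrite -!mulrDl ltr_pM2r //; move: H; rewrite mulrDl -!pmulrn; lra.
  - rewrite -(ler_nat R) -ler_ln ?X_gt0 ?posrE // lnX k_pred -divn.
    by rewrite ler_pM2r //; move: H; rewrite mulrDl -!pmulrn; lra.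
(* Here [K <= k + 1], so the shorter sequence is long enough. *)
- apply: leq_ltn_trans (pm_davenport_gt_binary _ _ hn le_k).
  by rewrite -ltnS -(@ltn_exp2l 2) //; apply: leq_ltn_trans lt_9n.
- have k1_gt0 : (0 < k.-1)%N by lia.
  (* In general [9 * n < 3 * 2 ^ (k + 1) < 2 ^ (k + 3)], so [K <= k + 2], the length of the second
     sequence. *)
  apply: leq_ltn_trans (pm_davenport_gt_binary3 _ _ k1_gt0 le_n).
  rewrite (ltn_predK k_gt1) -ltnS -(@ltn_exp2l 2) //.
  by apply: leq_ltn_trans le_K _; move: lt_k; rewrite !expnS; lia.
Qed.
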